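(* Let $d\ge 1$ be an integer, $p\ge d$, $\gamma>p/d$, $\alpha>0$, $\delta>0$, and let $B$ be an open ball of $\mathbb{R}^d$. (i) If $p>d$, then for every $M>0$ there exists $u\in L^1(B)$ such that $$I_{\delta,p}(u,B)\le M\quad\text{and}\quad \int_B \exp\Big(\alpha\,\gamma^{\delta^{-1}|u(x)-u_B|}\Big)\,dx=+\infty.$$ (ii) If $p=d$, then there exists a sequence $(u_n)\subset L^1(B)$, bounded in $L^1(B)$, such that $$\lim_{n\to+\infty}I_{\delta,p}(u_n,B)=0\quad\text{and}\quad \lim_{n\to+\infty}\int_B \exp\Big(\alpha\,\big(\delta^{-1}|u_n(x)-(u_n)_B|\big)^{\gamma}\Big)\,dx=+\infty.$$
   Context: Functions are real-valued. For a measurable set $O\subset\mathbb{R}^d$, $|O|$ denotes its Lebesgue measure, and for $u\in L^1(O)$ with $0<|O|<\infty$, $u_O=\frac{1}{|O|}\int_O u\,dx$. For $d\ge 1$, $p\ge 1$, $\delta>0$, a measurable set $O\subset\mathbb{R}^d$ and a measurable function $u$ on $O$, $$I_{\delta,p}(u,O)=\iint_{\{(x,y)\in O\times O:\ |u(x)-u(y)|>\delta\}}\frac{\delta^p}{|x-y|^{d+p}}\,dx\,dy\in[0,+\infty].$$ *)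

(* Defs.v *)
From HB Require Import structures.
From mathcomp Require Import all_boot all_order all_algebra.
From mathcomp Require Import all_classical all_reals all_analysis.

Set Implicit Arguments.
Unset Strict Implicit.
Unset Printing Implicit Defensive.

Import Order.TTheory GRing.Theory Num.Theory numFieldNormedType.Exports.

Local Open Scope classical_set_scope.
Local Open Scope ring_scope.

(* R^d is d.-tuple (measurableTypeR R), with the product sigma-algebra of
   tuples (the Borel sets of R^d); measurableTypeR R is convertible to R and
   carries the measurable structure lebesgue_measure is stated with. *)
Section tuple_cons.
Context {R : realType}.
Local Notation mR := (measurableTypeR R).

Definition tcons n (x : (mR * n.-tuple mR)%type) : n.+1.-tuple mR :=
  [the n.+1.-tuple mR of x.1 :: x.2].

Definition tuncons n (x : n.+1.-tuple mR) : (mR * n.-tuple mR)%type :=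
  (thead x, [tuple of behead x]).

Lemma measurable_tcons n : measurable_fun setT (@tcons n).
Proof. exact: measurable_cons. Qed.

Lemma measurable_tuncons n : measurable_fun setT (@tuncons n).
Proof.
apply/measurable_fun_pairP; split => /=.
  exact: (measurable_tnth (ord0 : 'I_n.+1)).
exact: measurable_behead.
Qed.

Lemma tconsK n : cancel (@tcons n) (@tuncons n).
Proof. by case=> x t; congr pair; apply/val_inj. Qed.

Lemma tunconsK n : cancel (@tuncons n) (@tcons n).
Proof. by move=> x; rewrite [RHS]tuple_eta; apply/val_inj. Qed.

End tuple_cons.

Lemma product_sigma_finite d1 d2 (T1 : measurableType d1)
    (T2 : measurableType d2) (R : realType)
    (m1 : {sigma_finite_measure set T1 -> \bar R})
    (m2 : {sigma_finite_measure set T2 -> \bar R}) :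
  sigma_finite setT (m1 \x m2)%E.
Proof.
have /sigma_finiteP[F [TF ndF Foo]] := sigma_finiteT m1.
have /sigma_finiteP[G [TG ndG Goo]] := sigma_finiteT m2.
exists (fun n => F n `*` G n).
  rewrite -setXTT TF TG predeqE => -[x y]; split.
    move=> [/= [n _ Fnx] [k _ Gky]]; exists (maxn n k) => //; split.
    - by move: x Fnx; exact/subsetPset/ndF/leq_maxl.
    - by move: y Gky; exact/subsetPset/ndG/leq_maxr.
  by move=> [n _ []/= ? ?]; split; exists n.
move=> k; have [? ?] := Foo k; have [? ?] := Goo k.
split; first exact: measurableX.
by rewrite product_measure1E// lte_mul_pinfty// ge0_fin_numE.
Qed.

Section product_tuple.
Context {R : realType} (n : nat).
Local Notation mR := (measurableTypeR R).
Variable m : {sigma_finite_measure set (n.-tuple mR) -> \bar R}.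

Definition lebesgue_product : set (n.+1.-tuple mR) -> \bar R :=
  pushforward (lebesgue_measure \x m)%E (@tcons R n).

Let measurable_pre (A : set (n.+1.-tuple mR)) :
  measurable A -> measurable (@tcons R n @^-1` A).
Proof. by move=> mA; rewrite -[X in measurable X]setTI; exact: measurable_tcons. Qed.

Let lebesgue_product0 : lebesgue_product set0 = 0%E.
Proof. by rewrite /lebesgue_product /pushforward preimage_set0 measure0. Qed.

Let lebesgue_product_ge0 A : (0 <= lebesgue_product A)%E.
Proof. by rewrite /lebesgue_product /pushforward; apply: measure_ge0. Qed.

Let lebesgue_product_sigma_additive : semi_sigma_additive lebesgue_product.
Proof.
move=> F mF tF mUF; rewrite /lebesgue_product /pushforward preimage_bigcup.
apply: measure_semi_sigma_additive.
- by move=> i; exact: measurable_pre.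
- apply/trivIsetP => /= i j _ _ ij; rewrite -preimage_setI.
  by move/trivIsetP : tF => /(_ _ _ _ _ ij) ->//; rewrite preimage_set0.
- by rewrite -preimage_bigcup; exact: measurable_pre.
Qed.

HB.instance Definition _ := isMeasure.Build _ _ _ lebesgue_product
  lebesgue_product0 lebesgue_product_ge0 lebesgue_product_sigma_additive.

Let lebesgue_product_sigma_finite : sigma_finite setT lebesgue_product.
Proof.
have [F UF Foo] := product_sigma_finite lebesgue_measure m.
exists (fun k => @tuncons R n @^-1` F k).
  by rewrite -preimage_bigcup -UF preimage_setT.
move=> k; have [mF Fk] := Foo k; split.
  by rewrite -[X in measurable X]setTI; exact: measurable_tuncons.
rewrite /lebesgue_product /pushforward -comp_preimage.
by rewrite (_ : _ \o _ = id) ?preimage_id//; apply/funext => x /=; rewrite tconsK.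
Qed.

HB.instance Definition _ := Measure_isSigmaFinite.Build _ _ _
  lebesgue_product lebesgue_product_sigma_finite.

End product_tuple.

Section lebesgue_tuple.
Context {R : realType}.
Local Notation mR := (measurableTypeR R).

Fixpoint lebesgue_tuple (d : nat) :
    {sigma_finite_measure set (d.-tuple mR) -> \bar R} :=
  match d with
  | 0 => dirac ([tuple] : 0.-tuple mR)
  | n.+1 => lebesgue_product (lebesgue_tuple n)
  end.
End lebesgue_tuple.

Section functional.
Context {R : realType} {d : nat}.
Local Notation Rd := (d.-tuple (measurableTypeR R)).

Definition edist (x y : Rd) : R :=
  Num.sqrt (\sum_(i < d) ((tnth x i : R) - (tnth y i : R)) ^+ 2).

Definition eball (c : Rd) (r : R) : set Rd := [set x | edist x c < r].

Definition mean (O : set Rd) (u : Rd -> R) : R :=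
  (fine (lebesgue_tuple d O))^-1 * \int[lebesgue_tuple d]_(x in O) u x.

(* On the domain of integration u z.1 != u z.2, so the distance is nonzero. *)
Definition Idp (delta p : R) (u : Rd -> R) (O : set Rd) : \bar R :=
  (\int[lebesgue_tuple d \x lebesgue_tuple d]_(z in
      [set z : Rd * Rd | [/\ O z.1, O z.2 & delta < `|u z.1 - u z.2|]%R])
    (delta `^ p / edist z.1 z.2 `^ (d%:R + p))%:E)%E.

End functional.

(* Main.v *)
Require Import Defs.
From HB Require Import structures.
From mathcomp Require Import all_boot all_order all_algebra.
From mathcomp Require Import all_classical all_reals all_analysis.
From mathcomp Require Import measurable_realfun zify ring lra.

Set Implicit Arguments.
Unset Strict Implicit.
Unset Printing Implicit Defensive.

Import Order.TTheory GRing.Theory Num.Theory numFieldNormedType.Exports.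

Local Open Scope classical_set_scope.
Local Open Scope ring_scope.

(** Both examples are step functions on a nested sequence of cubes [Q_k] of
half-side [s_k], centred at the centre of the ball and at least halving at each
step: away from the centre, [u] is [delta] times the number of cubes containing
the point.

Neighbouring levels of [u] differ by exactly [delta], and the functional only
sees pairs with [|u x - u y| > delta].  Such a pair skips a level: one point is
in some [Q_(k+1)] and the other outside [Q_k] ([steps_separated]), at a distance
comparable to its distance to the centre.  Integrating the kernel over these
pairs costs about [s_(k+1)^d / s_k^p] ([integral_kernel_far]), so that
[Idp delta p u] is at most a constant times [\sum_k s_(k+1)^d / s_k^p]
([Idp_nested]).  The integral over the points far from the centre is obtained by
cutting the complement of [Q_k] into dyadic shells; every set involved is then a
product of sets of known measure, on which the kernel has a constant bound.

On the other hand [u = delta * (n+1)] on [Q_n \ Q_(n+1)], whose measure is at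
least [(2 s_n)^d / 2], and the mean of [u] is bounded because the measures of
the cubes decay geometrically.  Hence the exponential integral is at least
[(2 s_n)^d / 2 * exp (alpha * phi (n + 1 - K))], where [delta * K] bounds the mean
and [phi t] is [gamma `^ t] or [t `^ gamma] ([exp_integral_steps_ge]).

It remains to choose the radii.  When [p > d], take [s_k = exp (- A q^k)] with
[p / d < q < gamma]: as [q d > p] the sum is finite and tends to [0] as [A]
grows ([dexp_sum_le]), while [gamma^n] beats [q^n] ([near_geometric_gap]).  When
[p = d], take [N] levels with ratio [N^-2]: the sum is at most [N * N^-2]
([fgeo_sum_le]), while [N^gamma] beats [N ln N] ([near_power_gap]). *)

(** * Cubes and balls *)

Section cubes.
Context {R : realType}.
Local Notation mR := (measurableTypeR R).

Definition cube d (c : d.-tuple mR) (s : R) : set (d.-tuple mR) :=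
  [set x | forall i, `|(tnth x i : R) - (tnth c i : R)| < s].

Lemma measurable_coord d (i : 'I_d) :
  measurable_fun setT (fun x : d.-tuple mR => (tnth x i : R)).
Proof. exact: (@measurable_tnth _ mR). Qed.

Lemma measurable_cube d (c : d.-tuple mR) s : measurable (cube c s).
Proof.
rewrite (_ : cube c s = \bigcap_(i in setT)
  [set x | `|(tnth x i : R) - (tnth c i : R)| < s]); last first.
  by apply/seteqP; split => [x cx i _|x cx i]; [exact: cx|exact: (cx i I)].
apply: fin_bigcap_measurable => [|i _]; first exact: finite_finset.
rewrite -[X in measurable X]setTI.
apply: (@measurable_fun_ltr _ _ R setT
  (fun x : d.-tuple mR => `|(tnth x i : R) - (tnth c i : R)|)
  (cst s) _ _ measurableT [set true]) => //.
apply: measurableT_comp => //; apply: measurable_funB => //.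
exact: measurable_coord.
Qed.

Lemma cube0 d (c : d.-tuple mR) : (0 < d)%N -> cube c 0 = set0.
Proof.
case: d c => // d c _; apply/seteqP; split => // x /(_ ord0).
by rewrite ltNge normr_ge0.
Qed.

Lemma subset_cube d (c : d.-tuple mR) (s t : R) : s <= t -> cube c s `<=` cube c t.
Proof. by move=> st x cx i; exact: lt_le_trans (cx i) st. Qed.

Lemma lebesgue_cube d (c : d.-tuple mR) (s : R) : 0 <= s ->
  lebesgue_tuple d (cube c s) = ((2 * s) ^+ d)%:E.
Proof.
move=> s0; elim: d c => [|d IH] c.
  by rewrite /= diracE expr0 mem_set//; case.
rewrite /= /lebesgue_product /pushforward.
(* Seen through [tcons], a cube is an interval times a cube of lower dimension. *)
have tcons0 a x : tnth (@tcons R d (a, x)) ord0 = a by rewrite (tnth_nth a).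
have tconsS a x i : tnth (@tcons R d (a, x)) (lift ord0 i) = tnth x i.
  by rewrite !(tnth_nth a).
have tnth_behead_lift i :
    tnth [tuple of behead c] i = tnth c (lift ord0 i).
  by rewrite tnth_behead; congr tnth; apply/val_inj; rewrite /= inordK// ltnS.
have -> : @tcons R d @^-1` cube c s =
    `]((thead c : R) - s), ((thead c : R) + s)[%classic `*`
      cube [tuple of behead c] s.
  apply/seteqP; split => [[a x] /= cx|[a x] /= []].
    split=> [|i] /=.
      by have := cx ord0; rewrite in_itv/= ltr_distl tcons0.
    by have := cx (lift ord0 i); rewrite tnth_behead_lift tconsS.
  rewrite in_itv/= -ltr_distl => ca cx i.
  case: (unliftP ord0 i) => [j ->|->]; last by rewrite tcons0.
  by have := cx j; rewrite tnth_behead_lift tconsS.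
have itvE : lebesgue_measure `]((thead c : R) - s), ((thead c : R) + s)[%classic
    = (2 * s)%:E.
  rewrite lebesgue_measure_itv/= lte_fin; case: ltP => s_lt.
    by rewrite -EFinD; congr EFin; ring.
  have -> : s = 0 by lra.
  by rewrite mulr0.
rewrite product_measure1E//; last exact: measurable_cube.
by rewrite [X in (X * _)%E]itvE IH -EFinM exprS.
Qed.

Lemma measurable_edist d :
  measurable_fun setT (fun z : d.-tuple mR * d.-tuple mR => Defs.edist z.1 z.2).
Proof.
apply: measurableT_comp => /=.
  by apply: continuous_measurable_fun; exact: sqrt_continuous.
apply: measurable_sum => i; apply: measurable_funX; apply: measurable_funB => //=.
  by apply: (measurableT_comp (measurable_coord i)).
by apply: (measurableT_comp (measurable_coord i)).
Qed.

Lemma measurable_eball d (c : d.-tuple mR) r : measurable (eball c r).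
Proof.
rewrite -[X in measurable X]setTI.
apply: (@measurable_fun_ltr _ _ R setT
  (fun x : d.-tuple mR => Defs.edist x c) (cst r) _ _ measurableT [set true]) => //.
apply: (measurableT_comp (@measurable_edist d) (g := fun x => (x, c))).
exact: measurable_fun_pair.
Qed.

(** Each coordinate is less than [r / d], hence its square is less than
[r ^+ 2 / d]. *)
Lemma cube_sub_eball d (c : d.-tuple mR) (r : R) : (0 < d)%N -> 0 < r ->
  cube c (r / d%:R) `<=` eball c r.
Proof.
move=> d0 r0 x cx; rewrite /eball /= /Defs.edist.
rewrite -[ltRHS]gtr0_norm// -sqrtr_sqr ltr_sqrt ?exprn_gt0//.
have d1 : (0 : R) < d%:R by rewrite ltr0n.
apply: (@le_lt_trans _ _ (\sum_(i < d) r / d%:R * `|(tnth x i : R) - tnth c i|)).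
  apply: ler_sum => i _; rewrite -real_normK ?num_real// expr2 ler_wpM2r//.
  exact/ltW/cx.
apply: (@lt_le_trans _ _ (\sum_(i < d) r / d%:R * r)).
  apply: ltr_sum.
    by apply/hasP; exists (Ordinal d0); rewrite ?mem_index_enum.
  move=> i _; rewrite ltr_pM2l ?divr_gt0//; apply: lt_le_trans (cx i) _.
  by rewrite ler_pdivrMr// ler_peMr ?(ltW r0)// ler1n.
rewrite sumr_const card_ord -[(_ * r) *+ d]mulr_natr.
rewrite (_ : r / d%:R * r * d%:R = r ^+ 2)//.
by field; rewrite gt_eqF.
Qed.

Lemma coord_le_edist d (x y : d.-tuple mR) i :
  `|(tnth x i : R) - (tnth y i : R)| <= Defs.edist x y.
Proof.
rewrite /Defs.edist -sqrtr_sqr ler_wsqrtr// (bigD1 i)//= lerDl sumr_ge0// => j _.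
exact: sqr_ge0.
Qed.

End cubes.

(** * Sums and covers *)

Section sums.
Context {R : realType}.

Lemma eseries_geometric (a z : R) : 0 <= z < 1 ->
  (\sum_(0 <= k <oo) (a * z ^+ k)%:E = (a / (1 - z))%:E)%E.
Proof.
move=> /andP[z0 z1]; apply/cvg_lim => //.
under eq_fun do rewrite sumEFin.
apply/cvg_EFin; first by apply: nearW.
by apply: cvg_geometric_series; rewrite ger0_norm.
Qed.

(** Countable subadditivity of the measure of density [f], obtained by making
the cover disjoint. *)
Lemma ge0_integral_cover d (T : measurableType d)
    (mu : {measure set T -> \bar R}) (D : set T) (A : (set T)^nat)
    (f : T -> \bar R) :
  measurable D -> (forall n, measurable (A n)) -> measurable_fun setT f ->
  (forall x, 0 <= f x)%E -> D `<=` \bigcup_n A n ->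
  (\int[mu]_(x in D) f x <= \sum_(0 <= n <oo) \int[mu]_(x in A n) f x)%E.
Proof.
move=> mD mA mf f0 DA; have mB := seqDU_measurable mA.
apply: (@le_trans _ _ (\int[mu]_(x in \bigcup_n seqDU A n) f x)%E).
  rewrite -seqDU_bigcup_eq; apply: ge0_subset_integral => //.
    exact: bigcup_measurable.
  exact: measurable_funTS.
rewrite ge0_integral_bigcup//; last exact: measurable_funTS.
apply: lee_nneseries => [n _ _|n _]; first exact: integral_ge0.
apply: ge0_subset_integral => //; last exact: subset_seqDU.
exact: measurable_funTS.
Qed.
End sums.

(** * The interaction of nested cubes *)

Section kernel.
Context {R : realType} (d : nat) (p delta : R).
Local Notation mR := (measurableTypeR R).
Local Notation Rd := (d.-tuple mR).
Hypotheses (p1 : 1 <= p) (delta0 : 0 < delta).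

Let mu := @lebesgue_tuple R d.

Definition kernel (z : Rd * Rd) : \bar R :=
  (delta `^ p / Defs.edist z.1 z.2 `^ (d%:R + p))%:E.

Let kernel_ge0 z : (0 <= kernel z)%E.
Proof. by rewrite lee_fin divr_ge0// powR_ge0. Qed.

Lemma measurable_kernel : measurable_fun setT kernel.
Proof.
apply/measurable_EFinP; rewrite /kernel.
under eq_fun do rewrite -powRN.
apply: measurable_funM => //.
apply: (@measurableT_comp _ _ _ _ _ _ (fun t : R => t `^ (- (d%:R + p)))).
  exact: measurable_powR.
exact: measurable_edist.
Qed.

Lemma edistC (x y : Rd) : Defs.edist x y = Defs.edist y x.
Proof.
rewrite /Defs.edist; congr Num.sqrt; apply: eq_bigr => i _.
by rewrite -sqrrN opprB.
Qed.

Lemma integral_kernel_rect (A B : set Rd) (a alpha beta : R) :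
  measurable A -> measurable B -> 0 < a ->
  (forall x y, A x -> B y -> a <= Defs.edist x y) ->
  (mu A <= alpha%:E)%E -> (mu B <= beta%:E)%E ->
  (\int[mu \x mu]_(z in A `*` B) kernel z
    <= (delta `^ p / a `^ (d%:R + p) * (alpha * beta))%:E)%E.
Proof.
move=> mA mB a0 AB mua mub.
have mAB : measurable (A `*` B) by exact: measurableX.
apply: (@le_trans _ _
  (\int[mu \x mu]_(z in A `*` B) (cst (delta `^ p / a `^ (d%:R + p))%:E z))%E).
  apply: ge0_le_integral => //.
    exact: measurable_funTS measurable_kernel.
  move=> [x y] /= [Ax By]; rewrite lee_fin ler_wpM2l ?powR_ge0//.
  have ad := AB _ _ Ax By.
  rewrite lef_pV2 ?posrE ?powR_gt0// ?(lt_le_trans a0)//.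
  apply: ge0_ler_powR; rewrite ?nnegrE ?(ltW a0)//; last exact: le_trans (ltW a0) ad.
  by rewrite addr_ge0// (le_trans ler01).
rewrite integral_cst//.
rewrite [X in (_ * X)%E](_ : _ = mu A * mu B)%E; last exact: product_measure1E.
rewrite (EFinM _ (alpha * beta)).
apply: lee_wpmul2l; first by rewrite lee_fin divr_ge0// powR_ge0.
by rewrite EFinM; apply: lee_pmul.
Qed.

(** Dyadic annulus around [c], for the supremum norm. *)
Definition shell (c : Rd) (s : R) (j : nat) : set Rd :=
  cube c (2 ^+ j.+1 * s) `\` cube c (2 ^+ j * s).

Lemma measurable_shell c s j : measurable (shell c s j).
Proof. by apply: measurableD; exact: measurable_cube. Qed.

(** A point outside [cube c s] is in the shell ending at the first dilate
[2 ^+ n * s] that contains it. *)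
Lemma cubeC_shells (c : Rd) s : 0 < s -> ~` cube c s `<=` \bigcup_j shell c s j.
Proof.
move=> s0 y ncy.
have : exists n, `[< cube c (2 ^+ n * s) y >].
  pose S := \sum_(i < d) `|(tnth y i : R) - tnth c i|.
  exists (Num.bound (S / s)); apply/asboolP => i.
  apply: (@le_lt_trans _ _ S).
    by rewrite /S (bigD1 i)//= lerDl sumr_ge0.
  rewrite -ltr_pdivrMr//; apply: (lt_le_trans (archi_boundP _)).
    by rewrite divr_ge0 ?(ltW s0)// sumr_ge0.
  by rewrite -natrX ler_nat ltnW// ltn_expl.
move=> /ex_minnP[[|j] /asboolP cy jmin].
  by move: cy; rewrite expr0 mul1r.
by exists j => //; split => // /asboolP/jmin; rewrite ltnn.
Qed.

(** Some coordinate of [y - c] is at least [2 ^+ j * s], and the halving of the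
radii bounds that of [x - c] by half of this. *)
Lemma shell_far (c : Rd) s t j x y : 0 < s -> t <= s / 2 ->
  cube c t x -> shell c s j y -> 2 ^+ j * s / 2 <= Defs.edist x y.
Proof.
move=> s0 ts cx [_ /existsNP[i /negP]]; rewrite -leNgt => cy.
apply: le_trans (coord_le_edist _ _ i).
have cxi := lt_le_trans (cx i) ts.
have js : s <= 2 ^+ j * s by rewrite ler_peMl ?(ltW s0)// exprn_ege1// ler1n.
have := ler_normD ((tnth y i : R) - tnth x i) ((tnth x i : R) - tnth c i).
rewrite [X in `|X| <= _](_ : _ = (tnth y i : R) - tnth c i); last by ring.
by rewrite [`|(tnth y i : R) - tnth x i|]distrC; lra.
Qed.

(** The constant in front of [t ^+ d / s `^ p] in the contribution of a single
shell: [delta `^ p] comes from the kernel, [2 `^ p] from the halved distance,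
and [16] is [2 * 8], the side of the inner cube over [t] times the side of the
shell over its distance to the inner cube. *)
Definition kernel_const : R := delta `^ p * 2 `^ p * 16 ^+ d.

Lemma kernel_const_gt0 : 0 < kernel_const.
Proof. by rewrite !mulr_gt0 ?exprn_gt0 ?powR_gt0. Qed.

(** In terms of the distance [a := 2 ^+ j * s / 2] to the inner cube, the shell has
volume at most [(8 * a) ^+ d], which cancels [a `^ d] in the kernel and leaves
[a `^ (- p)]; this decays at least like [2 ^- j] since [1 <= p]. *)
Lemma shell_term (s t : R) j : 0 < s -> 0 <= t ->
  delta `^ p / (2 ^+ j * s / 2) `^ (d%:R + p) *
    ((2 * t) ^+ d * (2 * (2 ^+ j.+1 * s)) ^+ d)
  <= kernel_const * (t ^+ d / s `^ p) * 2^-1 ^+ j.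
Proof.
move=> s0 t0; set a := 2 ^+ j * s / 2.
have j0 : (0 : R) < 2 ^+ j by rewrite exprn_gt0.
have a0 : 0 < a by rewrite divr_gt0// mulr_gt0.
have -> : 2 * (2 ^+ j.+1 * s) = 8 * a by rewrite /a exprS; field.
rewrite powRD; last by rewrite (gt_eqF a0) implybT.
rewrite powR_mulrn ?(ltW a0)// [(2 * t) ^+ d]exprMn [(8 * a) ^+ d]exprMn.
have aE : a `^ p = (2 ^+ j) `^ p * s `^ p / 2 `^ p.
  by rewrite /a powRM ?powRM ?mulr_ge0 ?(ltW j0) ?(ltW s0)// -powR_inv1// -powRAC
    powR_inv1// powR_ge0.
have ad : 0 < a ^+ d by rewrite exprn_gt0.
have ap : 0 < a `^ p by rewrite powR_gt0.
have sp : 0 < s `^ p by rewrite powR_gt0.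
have jp : 2 ^+ j <= (2 ^+ j) `^ p.
  by rewrite -[leLHS]powRr1 ?(ltW j0)// ler_powR// exprn_ege1// ler1n.
have -> : delta `^ p / (a ^+ d * a `^ p) * (2 ^+ d * t ^+ d * (8 ^+ d * a ^+ d))
    = delta `^ p * (2 ^+ d * 8 ^+ d) * t ^+ d / a `^ p.
  by field; rewrite !gt_eqF.
rewrite -exprMn (_ : 2 * 8 = 16)//; last by rewrite -natrM.
rewrite aE /kernel_const.
have p2 : 0 < 2 `^ p :> R by rewrite powR_gt0.
have jp0 : 0 < (2 ^+ j) `^ p :> R by rewrite powR_gt0.
rewrite (_ : _ / _ = delta `^ p * 2 `^ p * 16 ^+ d * (t ^+ d / s `^ p) *
   ((2 ^+ j) `^ p)^-1); last by field; rewrite !gt_eqF.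
rewrite ler_wpM2l//; last by rewrite exprVn lef_pV2.
by rewrite !mulr_ge0 ?invr_ge0 ?powR_ge0 ?exprn_ge0.
Qed.

(** Summing [shell_term] over the shells: the two bounds are those of the two
orders of the pair. *)
Lemma integral_kernel_far (c : Rd) (s t : R) : 0 < s -> 0 <= t <= s / 2 ->
  (\int[mu \x mu]_(z in cube c t `*` ~` cube c s) kernel z
    <= (2 * kernel_const * (t ^+ d / s `^ p))%:E /\
   \int[mu \x mu]_(z in ~` cube c s `*` cube c t) kernel z
    <= (2 * kernel_const * (t ^+ d / s `^ p))%:E)%E.
Proof.
move=> s0 /andP[t0 ts].
have mQ r := measurable_cube c r.
have mS := measurable_shell c s.
have sumE : (2 * kernel_const * (t ^+ d / s `^ p))%:E =
    (\sum_(0 <= j <oo) (kernel_const * (t ^+ d / s `^ p) * 2^-1 ^+ j)%:E)%E.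
  by rewrite eseries_geometric; [congr EFin; field; rewrite gt_eqF ?powR_gt0|lra].
have a0 j : 0 < 2 ^+ j * s / 2 by rewrite divr_gt0// mulr_gt0// exprn_gt0.
have muQ r : 0 <= r -> (mu (cube c r) <= ((2 * r) ^+ d)%:E)%E.
  by move=> r0; rewrite /mu lebesgue_cube.
have muS j : (mu (shell c s j) <= ((2 * (2 ^+ j.+1 * s)) ^+ d)%:E)%E.
  apply: le_trans (muQ _ _); last by rewrite mulr_ge0 ?(ltW s0)// exprn_ge0.
  apply: le_measure; rewrite ?inE//.
  exact: subDsetl.
split; rewrite sumE.
  apply: (@le_trans _ _ (\sum_(0 <= j <oo)
      \int[mu \x mu]_(z in cube c t `*` shell c s j) kernel z)%E).
    apply: ge0_integral_cover => //.
    - by apply: measurableX => //; apply: measurableC.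
    - by move=> j; apply: measurableX.
    - exact: measurable_kernel.
    - by move=> [x y] /= [cx /(cubeC_shells s0)[j _ cy]]; exists j.
  apply: lee_nneseries => [j _ _|j _]; first exact: integral_ge0.
  apply: le_trans (integral_kernel_rect (mQ t) (mS j) (a0 j) _ (muQ _ t0) (muS j)) _.
    by move=> x y; exact: shell_far.
  by rewrite lee_fin shell_term.
apply: (@le_trans _ _ (\sum_(0 <= j <oo)
    \int[mu \x mu]_(z in shell c s j `*` cube c t) kernel z)%E).
  apply: ge0_integral_cover => //.
  - by apply: measurableX => //; apply: measurableC.
  - by move=> j; apply: measurableX.
  - exact: measurable_kernel.
  - by move=> [x y] /= [/(cubeC_shells s0)[j _ cy] cx]; exists j.
apply: lee_nneseries => [j _ _|j _]; first exact: integral_ge0.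
apply: le_trans (integral_kernel_rect (mS j) (mQ t) (a0 j) _ (muS j) (muQ _ t0)) _.
  by move=> x y cx cy; rewrite edistC; exact: shell_far cy cx.
by rewrite lee_fin [X in _ * X]mulrC shell_term.
Qed.

(** The sets [Q_(k+1) * ~Q_k] and their mirror images cover the domain of
integration.  Vanishing radii are allowed, so that finite families of cubes are
covered too: the term is then zero, because [Q_(k+1)] is empty. *)
Lemma Idp_nested (c : Rd) (s : nat -> R) (O : set Rd) (u : Rd -> R) :
  (0 < d)%N -> measurable O -> measurable_fun setT u ->
  (forall k, 0 <= s k.+1 <= s k / 2) ->
  (forall x y, delta < `|u x - u y| -> exists k,
     cube c (s k.+1) x /\ ~ cube c (s k) y \/
     cube c (s k.+1) y /\ ~ cube c (s k) x) ->
  (Idp delta p u O <=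
   \sum_(0 <= k <oo) (4 * kernel_const * (s k.+1 ^+ d / s k `^ p))%:E)%E.
Proof.
move=> d0 mO mu_ s_half sep; rewrite /Idp.
have mQ r := measurable_cube c r.
pose A k := cube c (s k.+1) `*` ~` cube c (s k).
pose B k := ~` cube c (s k) `*` cube c (s k.+1).
have mA k : measurable (A k) by apply: measurableX => //; exact: measurableC.
have mB k : measurable (B k) by apply: measurableX => //; exact: measurableC.
apply: (@le_trans _ _
    (\sum_(0 <= k <oo) \int[mu \x mu]_(z in A k `|` B k) kernel z)%E).
  apply: ge0_integral_cover => //.
  - rewrite (_ : [set _ | _] = (O `*` O) `&`
        [set z | delta < `|u z.1 - u z.2|]); last first.
      by apply/seteqP; split => [z [? ? ?]|z [[? ?] ?]].
    apply: measurableI; first exact: measurableX.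
    rewrite -[X in measurable X]setTI.
    apply: (@measurable_fun_ltr _ _ R setT (cst delta)
      (fun z : Rd * Rd => `|u z.1 - u z.2|) _ _ measurableT [set true]) => //.
    apply: measurableT_comp => //; apply: measurable_funB => //.
      exact: measurableT_comp.
    exact: measurableT_comp.
  - by move=> k; exact: measurableU.
  - exact: measurable_kernel.
  - move=> [x y] /= [_ _ /sep[k [[? ?]|[? ?]]]]; exists k => //=.
      by left; split.
    by right; split.
apply: lee_nneseries => [k _ _|k _]; first exact: integral_ge0.
have /andP[t0 ts] := s_half k.
rewrite ge0_integral_setU//; last 2 first.
- exact: measurable_funTS measurable_kernel.
- apply/disj_setPS => -[x y] [[/= xk _] [/= nxk _]]; apply: nxk.
  by apply: subset_cube xk; lra.
have [s0|s0] := ltP 0 (s k).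
  have [HA HB] := integral_kernel_far c s0 (s_half k).
  apply: le_trans (leeD HA HB) _.
  by rewrite -EFinD lee_fin; lra.
have t_0 : s k.+1 = 0 by lra.
rewrite /A /B t_0 cube0// set0X setX0 !integral_set0 adde0 lee_fin.
by rewrite expr0n eqn0Ngt d0 mul0r mulr0.
Qed.
End kernel.

(** * Step functions on nested cubes *)

Section steps.
Context {R : realType} (d : nat) (delta : R).
Local Notation mR := (measurableTypeR R).
Local Notation Rd := (d.-tuple mR).
Variables (c : Rd) (s : nat -> R).
Hypothesis delta0 : 0 < delta.
Hypothesis s_half : forall k, 0 <= s k.+1 <= s k / 2.

Let mu := @lebesgue_tuple R d.

(** The number of cubes containing [x].  It is infinite at [c] when no radius
vanishes; [steps] is then [0] at [c], by the convention on [fine]. *)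
Definition depth (x : Rd) : \bar R :=
  (\sum_(0 <= k <oo) (\1_(cube c (s k)) x)%:E)%E.

Definition steps (x : Rd) : R := delta * fine (depth x).

Lemma radius_ge0 k : 0 <= s k.
Proof. by have := s_half k; lra. Qed.

Lemma radius_noninc k l : (k <= l)%N -> s l <= s k.
Proof.
move=> /subnKC <-; elim: (l - k)%N => [|n IH]; first by rewrite addn0.
by rewrite addnS; have := s_half (k + n); have := radius_ge0 (k + n); lra.
Qed.

Lemma radius_geometric k : s k <= s 0 * 2^-1 ^+ k.
Proof.
elim: k => [|k IH]; first by rewrite mulr1.
by rewrite exprS; have := s_half k; lra.
Qed.

Lemma depth_ge0 x : (0 <= depth x)%E.
Proof. exact: nneseries_ge0. Qed.

Lemma measurable_depth : measurable_fun setT depth.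
Proof.
apply: ge0_emeasurable_sum => [k x _ _|k _]; first by rewrite lee_fin.
by apply/measurable_EFinP; apply: measurable_indic; exact: measurable_cube.
Qed.

Lemma measurable_steps : measurable_fun setT steps.
Proof.
apply: measurable_funM => //.
by apply: measurableT_comp => //; exact: measurable_depth.
Qed.

Lemma depth_dichotomy x : (forall k, cube c (s k) x) \/
  exists m, forall k, cube c (s k) x <-> (k < m)%N.
Proof.
have [?|/existsNP[k0 nk0]] := pselect (forall k, cube c (s k) x); [by left|right].
have : exists k, ~~ `[< cube c (s k) x >] by exists k0; apply/asboolPn.
move=> /ex_minnP[m /asboolPn nm m_min]; exists m => k; split => [xk|km].
  rewrite ltnNge; apply/negP => mk; apply: nm.
  by apply: subset_cube xk; exact: radius_noninc.
by apply: contrapT => /asboolPn/m_min; rewrite leqNgt km.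
Qed.

Lemma stepsE x m : (forall k, cube c (s k) x <-> (k < m)%N) ->
  steps x = delta * m%:R.
Proof.
move=> xm; rewrite /steps /depth (nneseries_split 0 m)//.
rewrite add0n eseries0 ?adde0; last first.
  by move=> k mk _; rewrite indicE memNset// => /xm; rewrite ltnNge mk.
rewrite (eq_big_nat _ _ (F2 := fun=> 1%E)); last first.
  by move=> k /andP[_ km]; rewrite indicE mem_set//; exact/xm.
by rewrite sumEFin/= big_const_nat subn0 iter_addr_0.
Qed.

(** If the depths of [x] and [y] are [m >= n + 2], then [x] is in [Q_(n+1)] and [y]
is not in [Q_n].  This stays true when [m] is infinite, whatever the value of
[steps] at that point. *)
Lemma steps_separated x y : delta < `|steps x - steps y| -> exists k,
     cube c (s k.+1) x /\ ~ cube c (s k) y \/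
     cube c (s k.+1) y /\ ~ cube c (s k) x.
Proof.
have [xall|[m xm]] := depth_dichotomy x; have [yall|[n yn]] := depth_dichotomy y.
- rewrite (_ : steps x = steps y) ?subrr ?normr0 ?ltNge ?(ltW delta0)//.
  rewrite /steps /depth; congr (_ * fine _); apply: eq_eseriesr => k _.
  by rewrite !indicE !mem_set.
- by move=> _; exists n; left; split => // /yn; rewrite ltnn.
- by move=> _; exists m; right; split => // /xm; rewrite ltnn.
rewrite (stepsE xm) (stepsE yn) -mulrBr normrM gtr0_norm// ltr_pMr//.
move=> mn; have [nm|nm] := leqP n m.
  exists n; left; split; last by move/yn; rewrite ltnn.
  apply/xm; move: mn; rewrite -natrB// ger0_norm// ltr1n; lia.
exists m; right; split; last by move/xm; rewrite ltnn.
apply/yn; move: mn; rewrite distrC -natrB ?(ltnW nm)// ger0_norm// ltr1n; lia.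
Qed.

Hypothesis d0 : (0 < d)%N.

(** The measures of the cubes are at most [(2 * s 0) ^+ d] times [2 ^- k], and the
latter sum to [2]. *)
Lemma integral_steps_le (O : set Rd) : measurable O ->
  (\int[mu]_(x in O) `|steps x|%:E <= (2 * delta * (2 * s 0) ^+ d)%:E)%E.
Proof.
move=> mO.
apply: (@le_trans _ _ (\int[mu]_x (delta%:E * depth x))%E).
  apply: (@le_trans _ _ (\int[mu]_x `|steps x|%:E)%E).
    apply: ge0_subset_integral => //.
    apply/measurable_EFinP; apply: measurableT_comp => //.
    exact: measurable_steps.
  apply: ge0_le_integral => //.
  - apply/measurable_EFinP; apply: measurableT_comp => //.
    exact: measurable_steps.
  - by apply: emeasurable_funM => //; exact: measurable_depth.
  move=> x _; rewrite ger0_norm ?mulr_ge0 ?(ltW delta0) ?fine_ge0 ?depth_ge0//.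
  rewrite EFinM; apply: lee_wpmul2l; first by rewrite lee_fin ltW.
  by have := depth_ge0 x; case: (depth x) => //= _; exact: leey.
rewrite ge0_integralZl//; last 3 first.
- exact: measurable_depth.
- by move=> x _; exact: depth_ge0.
- by rewrite lee_fin ltW.
rewrite integral_nneseries//; last first.
  move=> k; apply/measurable_EFinP; apply: measurable_indic.
  exact: measurable_cube.
rewrite (_ : 2 * delta * _ = delta * ((2 * s 0) ^+ d / (1 - 2^-1))); last by field.
rewrite EFinM; apply: lee_wpmul2l; first by rewrite lee_fin ltW.
rewrite -eseries_geometric; last by lra.
apply: lee_nneseries => [k _ _|k _].
  by apply: integral_ge0 => x _; rewrite lee_fin.
rewrite integral_indic//; last exact: measurable_cube.
rewrite setIT [leLHS](lebesgue_cube c (radius_ge0 k)) lee_fin.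
have half1 : (2^-1 : R) ^+ k <= 1 by rewrite exprn_ile1//; lra.
have half0 : (0 : R) <= 2^-1 ^+ k by rewrite exprn_ge0.
apply: (@le_trans _ _ ((2 * s 0 * 2^-1 ^+ k) ^+ d)).
  rewrite ler_pXn2r ?nnegrE ?mulr_ge0 ?radius_ge0//.
  by rewrite -mulrA ler_pM2l// radius_geometric.
rewrite exprMn ler_wpM2l ?exprn_ge0 ?mulr_ge0 ?radius_ge0//.
by apply: ler_iXnr; rewrite ?half0.
Qed.

Lemma integrable_steps (O : set Rd) : measurable O ->
  mu.-integrable O (EFin \o steps).
Proof.
move=> mO; apply/integrableP; split.
  by apply/measurable_EFinP; exact: measurable_funTS measurable_steps.
by apply: le_lt_trans (integral_steps_le mO) _; exact: ltry.
Qed.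

Lemma normr_mean_steps_le (O : set Rd) : measurable O ->
  `|mean O steps| <= delta * ((fine (mu O))^-1 * (2 * (2 * s 0) ^+ d)).
Proof.
move=> mO; rewrite /mean normrM ger0_norm ?invr_ge0 ?fine_ge0//.
rewrite mulrCA ler_wpM2l ?invr_ge0 ?fine_ge0//.
apply: le_trans (le_normr_Rintegral mO (integrable_steps mO)) _.
rewrite /Rintegral -lee_fin fineK.
  by apply: le_trans (integral_steps_le mO) _; rewrite lee_fin; lra.
rewrite ge0_fin_numE; last exact: integral_ge0.
by apply: le_lt_trans (integral_steps_le mO) _; exact: ltry.
Qed.

(** The integral is restricted to [Q_n \ Q_(n+1)], where [steps] is exactly
[delta * (n + 1)]; halving the radius leaves at least half of the measure. *)
Lemma exp_integral_steps_ge (O : set Rd) (phi : R -> R) (alpha m K : R) n :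
  measurable O -> cube c (s 0) `<=` O -> measurable_fun setT phi ->
  {in Num.nneg &, {homo phi : x y / x <= y}} -> 0 <= alpha ->
  `|m| <= delta * K -> K <= n.+1%:R ->
  (((2 * s n) ^+ d / 2 * expR (alpha * phi (n.+1%:R - K)))%:E <=
    \int[mu]_(x in O) (expR (alpha * phi (delta^-1 * `|steps x - m|)))%:E)%E.
Proof.
move=> mO QO mphi phi_mono alpha0 mK Kn.
have mQ k : measurable (cube c (s k)) by exact: measurable_cube.
pose E := cube c (s n) `\` cube c (s n.+1).
have mE : measurable E by exact: measurableD.
have EO : E `<=` O.
  by move=> x [xn _]; apply: QO; apply: subset_cube xn; exact: radius_noninc.
have E_ge : (((2 * s n) ^+ d / 2)%:E <= mu E)%E.
  rewrite /E /mu measureD//=; last by rewrite lebesgue_cube ?radius_ge0// ltry.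
  rewrite setIidr; last by apply: subset_cube; exact: radius_noninc.
  rewrite !lebesgue_cube ?radius_ge0// -EFinB lee_fin.
  suff : (2 * s n.+1) ^+ d <= (2 * s n) ^+ d / 2 by lra.
  apply: (@le_trans _ _ ((2 * s n * 2^-1) ^+ d)).
    rewrite ler_pXn2r ?nnegrE ?mulr_ge0 ?radius_ge0//.
    by have := s_half n; lra.
  rewrite exprMn ler_wpM2l ?exprn_ge0 ?mulr_ge0 ?radius_ge0//.
  by apply: ler_iXnr => //; lra.
have mF : measurable_fun setT
    (fun x => (expR (alpha * phi (delta^-1 * `|steps x - m|)))%:E).
  apply/measurable_EFinP; apply: measurableT_comp => //.
  apply: measurable_funM => //; apply: measurableT_comp => //.
  apply: measurable_funM => //; apply: measurableT_comp => //.
  by apply: measurable_funB => //; exact: measurable_steps.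
apply: (@le_trans _ _ (\int[mu]_(x in E)
    (expR (alpha * phi (delta^-1 * `|steps x - m|)))%:E)%E); last first.
  by apply: ge0_subset_integral => //; exact: measurable_funTS.
apply: (@le_trans _ _ (\int[mu]_(x in E)
    (cst (expR (alpha * phi (n.+1%:R - K)))%:E x))%E).
  rewrite integral_cst// mulrC EFinM.
  by apply: lee_wpmul2l => //; exact: E_ge.
apply: ge0_le_integral => //.
- by move=> x _; rewrite lee_fin expR_ge0.
- exact: measurable_funTS.
move=> x [xn xn1]; rewrite lee_fin ler_expR ler_wpM2l// phi_mono ?nnegrE ?subr_ge0//.
  by rewrite mulr_ge0 ?invr_ge0 ?(ltW delta0).
rewrite (@stepsE x n.+1); last first.
  move=> k; split => [xk|kn].
    rewrite ltnNge; apply/negP => nk; apply: xn1.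
    by apply: subset_cube xk; exact: radius_noninc.
  by apply: subset_cube xn; exact: radius_noninc.
rewrite ler_pdivlMl//.
have := ler_distD 0 (delta * n.+1%:R) m; rewrite subr0 sub0r normrN.
have := lerB_dist (delta * n.+1%:R) m.
rewrite ger0_norm ?mulr_ge0 ?(ltW delta0)//.
by rewrite mulrBr; lra.
Qed.

End steps.

(** * Growth comparisons *)

Section growth.
Context {R : realType}.

Lemma bernoulli_ge (x : R) n : 0 <= x -> 1 + n%:R * x <= (1 + x) ^+ n.
Proof.
move=> x0; elim: n => [|n IH]; first by rewrite mul0r addr0.
have nx : 0 <= n%:R * x * x by rewrite !mulr_ge0.
rewrite exprS -natr1; apply: (@le_trans _ _ ((1 + x) * (1 + n%:R * x))); first lra.
by rewrite ler_wpM2l// addr_ge0.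
Qed.

Lemma expRN_le_half (t : R) : 1 <= t -> expR (- t) <= 2^-1.
Proof.
move=> t1; rewrite expRN lef_pV2 ?posrE ?expR_gt0//.
by have := expR_ge1Dx t; lra.
Qed.

Lemma expRN_le_inv (t : R) : 0 < t -> expR (- t) <= t^-1.
Proof.
move=> t0; rewrite expRN lef_pV2 ?posrE ?expR_gt0//.
by have := expR_ge1Dx t; lra.
Qed.

(** Writing [g = q * (1 + x)], Bernoulli's inequality makes [a * (g / q) ^+ n - D]
large, and it is multiplied by [q ^+ n >= 1]. *)
Lemma near_geometric_gap (a D q g M : R) : 0 < a -> 1 <= q -> q < g ->
  \forall n \near \oo, M <= a * g ^+ n - D * q ^+ n.
Proof.
move=> a0 q1 qg; have q0 : 0 < q by lra.
have x0 : 0 < g / q - 1 by rewrite subr_gt0 ltr_pdivlMr// mul1r.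
near=> n.
have gE : g ^+ n = q ^+ n * (1 + (g / q - 1)) ^+ n.
  by rewrite -exprMn; congr (_ ^+ _); field; rewrite gt_eqF.
have qn1 : 1 <= q ^+ n by rewrite exprn_ege1.
have nM : `|M| + `|D| <= n%:R * (a * (g / q - 1)).
  rewrite -ler_pdivrMr ?mulr_gt0//.
  by near: n; exact: nbhs_infty_ger.
have B := bernoulli_ge n (ltW x0).
have -> : a * g ^+ n - D * q ^+ n = q ^+ n * (a * (1 + (g / q - 1)) ^+ n - D).
  by rewrite gE; ring.
apply: (@le_trans _ _ (q ^+ n * `|M|)).
  by apply: le_trans (ler_norm M) _; rewrite ler_peMl.
rewrite ler_wpM2l ?(le_trans ler01)//.
have := ler_norm D.
have : a * (1 + n%:R * (g / q - 1)) <= a * (1 + (g / q - 1)) ^+ n.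
  by rewrite ler_wpM2l// ltW.
by lra.
Unshelve. all: by end_near. Qed.

(** With [e := (g - 1) / 2] and [N := n + 2], [ln N <= N `^ e / e] while
[N `^ g = N * N `^ e * N `^ e]: one factor [N `^ e] is left over.  The shift by [K]
only costs a factor [2 `^ g] once [N >= 2 * K]. *)
Lemma near_power_gap (a D K g M : R) : 0 < a -> 1 < g -> 0 <= D ->
  \forall n \near \oo,
    M <= a * (n.+2%:R - K) `^ g - D * (n.+2%:R * ln n.+2%:R).
Proof.
move=> a0 g1 D0; pose e := (g - 1) / 2.
have e0 : 0 < e by rewrite /e; lra.
pose b := a / 2 `^ g.
have g2 : 0 < 2 `^ g :> R by rewrite powR_gt0.
have b0 : 0 < b by rewrite divr_gt0.
(* The threshold for [N `^ e]: [b * L - D / e] is [`|M|]. *)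
pose L := (D / e + `|M|) / b.
have L0 : 0 <= L.
  by rewrite /L divr_ge0 ?(ltW b0)// addr_ge0// divr_ge0// ltW.
near=> n; set N : R := n.+2%:R.
have nN : n%:R <= N by rewrite ler_nat -addn2 leq_addr.
have N1 : 1 <= N by rewrite ler1n.
have N0 : 0 < N by rewrite (lt_le_trans ltr01).
have KN : 2 * K <= N.
  by apply: le_trans nN; near: n; exact: nbhs_infty_ger.
have LN : L <= N `^ e.
  have -> : L = (L `^ e^-1) `^ e by rewrite -powRrM mulVf ?gt_eqF// powRr1.
  apply: ge0_ler_powR; rewrite ?nnegrE ?powR_ge0 ?(ltW N0) ?(ltW e0)//.
  by apply: le_trans nN; near: n; exact: nbhs_infty_ger.
have Ne1 : 1 <= N `^ e by rewrite -(powRr0 N) ler_powR// ltW.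
have lnN : ln N <= N `^ e / e.
  rewrite ler_pdivlMr// mulrC -ln_powR ltW// ln_sublinear// powR_gt0//.
have powN : b * (N * (N `^ e * N `^ e)) <= a * (N - K) `^ g.
  have NgE : N `^ g = N * (N `^ e * N `^ e).
    rewrite -[X in X * _]powRr1 ?(ltW N0)//.
    rewrite -!powRD ?(gt_eqF N0) ?implybT//; congr (_ `^ _).
    by rewrite /e; field.
  have half_pow : (2^-1) `^ g = (2 `^ g)^-1 :> R.
    by rewrite -powR_inv1// -powRrM mulN1r powRN.
  rewrite -NgE /b -mulrA ler_wpM2l ?(ltW a0)// -half_pow -powRM ?(ltW N0)//.
  apply: ge0_ler_powR; rewrite ?nnegrE; lra.
apply: (@le_trans _ _ (N * N `^ e * (b * N `^ e - D / e))); last first.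
  have : D * (N * ln N) <= D * (N * (N `^ e / e)).
    by rewrite ler_wpM2l// ler_wpM2l// ltW.
  have -> : D * (N * (N `^ e / e)) = N * N `^ e * (D / e) by ring.
  have -> : N * N `^ e * (b * N `^ e - D / e) =
      b * (N * (N `^ e * N `^ e)) - N * N `^ e * (D / e) by ring.
  by lra.
have : `|M| <= b * N `^ e - D / e.
  have : b * L <= b * N `^ e by rewrite ler_wpM2l// ltW.
  by rewrite /L mulrC divfK ?gt_eqF//; lra.
move=> Mle; apply: le_trans (ler_norm M) (le_trans Mle _).
by rewrite ler_peMl ?mulr_ege1// (le_trans (normr_ge0 M)).
Unshelve. all: by end_near. Qed.

End growth.

(** * The radii of the cubes *)

Section double_exponential.
Context {R : realType} (d : nat) (p q A : R).
Hypotheses (q1 : 1 < q) (A0 : 0 < A).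

Definition dexp (k : nat) : R := expR (- (A * q ^+ k)).

Lemma dexp_half k : 1 <= A * (q - 1) -> 0 <= dexp k.+1 <= dexp k / 2.
Proof.
move=> Aq; rewrite expR_ge0 /= /dexp.
have -> : - (A * q ^+ k.+1) = - (A * q ^+ k) - A * (q - 1) * q ^+ k.
  by rewrite exprS; ring.
rewrite expRD ler_wpM2l ?expR_ge0// expRN_le_half//.
by rewrite mulr_ege1// exprn_ege1// ltW.
Qed.

(** The [k]-th term is exactly [exp (- A (q d - p) q^k)], and [q^k] is at
least [1 + k (q - 1)]. *)
Lemma dexp_sum_le : 0 < q * d%:R - p -> 1 <= A * (q * d%:R - p) * (q - 1) ->
  (\sum_(0 <= k <oo) (dexp k.+1 ^+ d / dexp k `^ p)%:E <=
    (2 * expR (- (A * (q * d%:R - p))))%:E)%E.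
Proof.
have [e eE] : exists e, e = q * d%:R - p by exists (q * d%:R - p).
rewrite -eE => e0 Ae.
have -> : 2 * expR (- (A * e)) = expR (- (A * e)) / (1 - 2^-1) by field.
rewrite -eseries_geometric; last lra.
apply: lee_nneseries => [k _ _|k _].
  by rewrite lee_fin divr_ge0 ?powR_ge0 ?exprn_ge0 ?expR_ge0.
rewrite lee_fin /dexp -expRM_natr -expRM -expRN -expRD.
apply: (@le_trans _ _ (expR (- (A * e) - k%:R))).
  rewrite ler_expR.
  have q10 : 0 <= q - 1 by rewrite subr_ge0 ltW.
  have := bernoulli_ge k q10; rewrite subrKC => B.
  have H1 : A * e * (1 + k%:R * (q - 1)) <= A * e * q ^+ k.
    by rewrite ler_wpM2l// mulr_ge0 ?(ltW A0) ?(ltW e0).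
  have H2 : k%:R <= k%:R * (A * e * (q - 1)) by rewrite ler_peMr.
  have -> : - (A * q ^+ k.+1) * d%:R - - (A * q ^+ k) * p = - (A * e * q ^+ k).
    by rewrite eE exprS; ring.
  by lra.
rewrite expRD ler_wpM2l ?expR_ge0//.
rewrite -[k%:R]mulr1 -mulrN expRM_natl.
by rewrite lerXn2r ?nnegrE ?expR_ge0 ?invr_ge0// expRN_le_half.
Qed.
End double_exponential.

Section finite_geometric.
Context {R : realType} (d : nat) (b : R) (n : nat).
Hypotheses (b0 : 0 < b).

Let rho : R := (n.+2%:R ^+ 2)^-1.

(** [n + 2] cubes with ratio [(n + 2)^-2], followed by empty ones. *)
Definition fgeo (k : nat) : R := if (k < n.+2)%N then b * rho ^+ k else 0.

Let rho_gt0 : 0 < rho.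
Proof. by rewrite invr_gt0 exprn_gt0. Qed.

Let rho_le : rho <= 2^-1.
Proof.
rewrite lef_pV2 ?posrE ?exprn_gt0//.
by rewrite -natrX ler_nat (@leq_trans (2 ^ 2)%N)// leq_sqr.
Qed.

Lemma fgeo_half k : 0 <= fgeo k.+1 <= fgeo k / 2.
Proof.
rewrite /fgeo; have [kn|kn] := ltnP k.+1 n.+2; last first.
  by case: ifP => _; rewrite lexx/= ?mul0r// divr_ge0// mulr_ge0 ?exprn_ge0 ?ltW.
rewrite (ltn_trans _ kn)// mulr_ge0 ?exprn_ge0 ?(ltW b0) ?(ltW rho_gt0)//=.
by rewrite exprSr mulrA ler_wpM2l// mulr_ge0 ?exprn_ge0 ?ltW.
Qed.

(** Each of the [n + 2] first terms is at most [C] times the ratio [(n + 2)^-2],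
and the others vanish. *)
Lemma fgeo_sum_le (C : R) : (0 < d)%N -> 0 <= C ->
  (\sum_(0 <= k <oo) (C * (fgeo k.+1 ^+ d / fgeo k `^ d%:R))%:E <=
    (C / n.+2%:R)%:E)%E.
Proof.
move=> d0 C0.
have fgeo0 k : 0 <= fgeo k.
  by rewrite /fgeo; case: ifP => // _; rewrite mulr_ge0 ?exprn_ge0 ?ltW.
rewrite (nneseries_split 0 n.+2); last first.
  by move=> k _; rewrite lee_fin mulr_ge0 ?divr_ge0 ?powR_ge0 ?exprn_ge0.
rewrite add0n eseries0 ?adde0; last first.
  move=> k nk _; rewrite {1}/fgeo ltnNge (leq_trans nk)//=.
  by rewrite expr0n eqn0Ngt d0 mul0r mulr0.
apply: (@le_trans _ _ (\sum_(0 <= k < n.+2) (C * rho)%:E)%E).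
  apply: lee_sum => k _; rewrite lee_fin ler_wpM2l//.
  rewrite powR_mulrn// {1}/fgeo; case: ltnP => kn; last first.
    by rewrite expr0n eqn0Ngt d0 mul0r ltW.
  rewrite /fgeo (ltn_trans _ kn)//.
  have bk : 0 < b * rho ^+ k by rewrite mulr_gt0// exprn_gt0.
  rewrite exprSr mulrA exprMn mulrAC divff ?mul1r; last by rewrite expf_neq0 ?gt_eqF.
  apply: ler_iXnr => //; first exact: ltW.
  by apply: le_trans rho_le _; lra.
rewrite sumEFin lee_fin big_const_nat subn0 iter_addr_0 -mulr_natr.
rewrite le_eqVlt; apply/orP; left; apply/eqP; rewrite /rho; field.
by rewrite gt_eqF// ltr0n.
Qed.

Lemma fgeo_last : fgeo n.+1 =
  b * expR (- (2 * ln n.+2%:R * n.+1%:R)).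
Proof.
rewrite /fgeo ltnSn /rho; congr (_ * _).
by rewrite -mulNr expRM_natr expRN expRM_natl lnK// posrE ltr0n.
Qed.
End finite_geometric.

(** * The two examples *)

Section examples.
Context {R : realType} (d : nat) (p gamma alpha delta : R).
Variables (c : d.-tuple (measurableTypeR R)) (r : R).
Hypotheses (d1 : (0 < d)%N) (dp : d%:R <= p) (pg : p / d%:R < gamma).
Hypotheses (alpha0 : 0 < alpha) (delta0 : 0 < delta) (r0 : 0 < r).

Let dR0 : (0 : R) < d%:R. Proof. by rewrite ltr0n. Qed.

Let p1 : 1 <= p. Proof. by apply: le_trans dp; rewrite ler1n. Qed.

Let g1 : 1 < gamma.
Proof. by apply: le_lt_trans pg; rewrite ler_pdivlMr// mul1r. Qed.

Let g0 : 0 < gamma. Proof. exact: lt_trans g1. Qed.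

Let mO : measurable (eball c r). Proof. exact: measurable_eball. Qed.

Let inner_cube : exists2 b, 0 < b & cube c b `<=` eball c r.
Proof. by exists (r / d%:R); [rewrite divr_gt0|exact: cube_sub_eball]. Qed.

(** Double exponential radii [exp (- A q^k)]: [p / d < q] makes the functional
small, [q < gamma] makes the exponential integral infinite. *)
Lemma infinite_exp_integral : d%:R < p ->
  forall M : R, 0 < M ->
     exists u : d.-tuple (measurableTypeR R) -> R,
       [/\ (lebesgue_tuple d).-integrable (eball c r) (EFin \o u),
           (Idp delta p u (eball c r) <= M%:E)%E &
           (\int[lebesgue_tuple d]_(x in eball c r)
              (expR (alpha * gamma `^
                 (delta^-1 * `|u x - mean (eball c r) u|)))%:E)%E = +oo%E].
Proof.
move=> ltdp M M0.
move: inner_cube (kernel_const_gt0 d p delta0)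
  (Idp_nested (d := d) (delta := delta) p1) => [b b0 QO].
move: (kernel_const d p delta) => C C0 Idp_le.
pose q := (p / d%:R + gamma) / 2.
have pq : p / d%:R < q by rewrite /q (midf_lt pg).
have qg : q < gamma by rewrite /q (midf_lt pg).
have q1 : 1 < q by apply: le_lt_trans pq; rewrite ler_pdivlMr// mul1r.
have e0 : 0 < q * d%:R - p by rewrite subr_gt0 -ltr_pdivrMr.
have q10 : 0 < q - 1 by rewrite subr_gt0.
clearbody q; set e := q * d%:R - p in e0 *.
(* [A] is larger than four thresholds: [A1] puts the first cube inside the ball,
   [A2] makes the radii halve, [A3] makes the terms of the sum halve, and [A4]
   brings the sum below [M]. *)
pose A1 := b^-1; pose A2 := (q - 1)^-1.
pose A3 := (e * (q - 1))^-1; pose A4 := 8 * C / (M * e).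
have A10 : 0 < A1 by rewrite invr_gt0.
have A20 : 0 < A2 by rewrite invr_gt0.
have A30 : 0 < A3 by rewrite invr_gt0 mulr_gt0.
have A40 : 0 < A4 by apply: divr_gt0; apply: mulr_gt0.
pose A := A1 + A2 + A3 + A4.
have A0 : 0 < A by rewrite /A; lra.
have A2le : 1 <= A * (q - 1) by rewrite -ler_pdivrMr// mul1r /A -/A2; lra.
have A3le : 1 <= A * e * (q - 1).
  by rewrite -mulrA -ler_pdivrMr ?mulr_gt0// mul1r /A -/A3; lra.
have A1le : expR (- A) <= b.
  apply: (le_trans (expRN_le_inv A0)).
  by rewrite invf_ple ?posrE// /A -/A1; lra.
have A4le : 8 * C * expR (- (A * e)) <= M.
  have Ae0 : 0 < A * e by rewrite mulr_gt0.
  apply: (@le_trans _ _ (8 * C * (A * e)^-1)).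
    by rewrite ler_wpM2l ?expRN_le_inv// mulr_ge0// ltW.
  rewrite ler_pdivrMr// mulrCA.
  rewrite -ler_pdivrMr ?mulr_gt0// -/A4 /A; lra.
have s_half k : 0 <= dexp q A k.+1 <= dexp q A k / 2 by exact: dexp_half.
have s0b : dexp q A 0 <= b by rewrite /dexp expr0 mulr1.
clearbody A; exists (steps delta c (dexp q A)); split.
- exact: integrable_steps.
- apply: le_trans (Idp_le c _ _ _ d1 mO _ s_half _) _.
  + exact: measurable_steps.
  + exact: steps_separated.
  under eq_eseriesr do rewrite EFinM.
  rewrite nneseriesZl; last first.
    by move=> k _; rewrite lee_fin divr_ge0 ?powR_ge0 ?exprn_ge0 ?expR_ge0.
  apply: le_trans (_ : _ <= (4 * C)%:E * (2 * expR (- (A * e)))%:E)%E _.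
    apply: lee_wpmul2l; first by rewrite lee_fin mulr_ge0 ?ltW.
    exact: dexp_sum_le.
  by rewrite -EFinM lee_fin; lra.
apply: eq_infty => M'.
pose K := (fine (lebesgue_tuple d (eball c r)))^-1 *
  (2 * (2 * dexp q A 0) ^+ d).
have QsO : cube c (dexp q A 0) `<=` eball c r.
  by apply: subset_trans QO; exact: subset_cube.
pose a := alpha * gamma `^ (1 - K).
have a0 : 0 < a by rewrite mulr_gt0 ?powR_gt0.
near \oo => n.
have Kn : K <= n.+1%:R.
  apply: (@le_trans _ _ n%:R); last by rewrite ler_nat.
  by near: n; exact: nbhs_infty_ger.
have gap : M' <= a * gamma ^+ n - A * d%:R * q ^+ n.
  by near: n; apply: near_geometric_gap => //; exact: ltW.
apply: le_trans (exp_integral_steps_ge delta0 s_half d1 mO QsO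
  (measurable_powRr _) _ (ltW alpha0)
  (normr_mean_steps_le c delta0 s_half d1 mO) Kn); last first.
  by move=> x y _ _; exact/ler_powR/ltW.
rewrite lee_fin.
have -> : alpha * gamma `^ (n.+1%:R - K) = a * gamma ^+ n.
  rewrite -natr1 -addrA powRD; last by rewrite (gt_eqF g0) implybT.
  by rewrite powR_mulrn ?(ltW g0)// mulrCA mulrC.
have shuffle (x y z : R) : x * y / 2 * z = x / 2 * (y * z) by field.
rewrite exprMn -expRM_natr shuffle -expRD.
have -> : - (A * q ^+ n) * d%:R + a * gamma ^+ n =
  a * gamma ^+ n - A * d%:R * q ^+ n by ring.
apply: (le_trans gap).
set T := a * gamma ^+ n - A * d%:R * q ^+ n.
apply: (@le_trans _ _ (expR T)); first by have := expR_ge1Dx T; lra.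
rewrite ler_peMl ?expR_ge0// ler_pdivlMr// mul1r.
by rewrite ler_eXnr// ler1n.
Unshelve. all: by end_near. Qed.

(** [N = n + 2] levels with radii of ratio [N^-2]: the functional is at most of
order [1 / N], while the step function is equal to [delta * N] on a cube whose
measure is at least a constant times [exp (- 2 d N ln N)]. *)
Lemma unbounded_exp_integral : p = d%:R ->
  exists u_ : nat -> d.-tuple (measurableTypeR R) -> R,
       [/\ forall n, (lebesgue_tuple d).-integrable (eball c r) (EFin \o u_ n),
           exists C : R, forall n,
             (\int[lebesgue_tuple d]_(x in eball c r) `|u_ n x|%:E <= C%:E)%E,
           Idp delta p (u_ n) (eball c r) @[n --> \oo] --> 0%E &
           (\int[lebesgue_tuple d]_(x in eball c r)
              (expR (alpha * (delta^-1 *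
                 `|u_ n x - mean (eball c r) (u_ n)|) `^ gamma))%:E)%E
             @[n --> \oo] --> +oo%E].
Proof.
move=> pd.
move: inner_cube (kernel_const_gt0 d p delta0)
  (Idp_nested (d := d) (delta := delta) p1) => [b b0 QO].
move: (kernel_const d p delta) => C C0 Idp_le.
pose s n := fgeo b n.
have s_half n k : 0 <= s n k.+1 <= s n k / 2 by exact: fgeo_half.
have s0 n : s n 0%N = b by rewrite /s /fgeo /= mulr1.
pose K := (fine (lebesgue_tuple d (eball c r)))^-1 * (2 * (2 * b) ^+ d).
exists (fun n => steps delta c (s n)); split.
- by move=> n; exact: integrable_steps.
- exists (2 * delta * (2 * b) ^+ d) => n; rewrite -(s0 n).
  exact: integral_steps_le.
- apply: (@squeeze_cvge _ _ _ _ (cst 0%E) _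
    (fun n => (4 * C / n.+2%:R)%:E)); [|exact: cvg_cst|].
    near=> n; apply/andP; split.
      by apply: integral_ge0 => z _; rewrite lee_fin divr_ge0 ?powR_ge0.
    apply: le_trans (Idp_le c _ _ _ d1 mO _ (s_half n) _) _.
    + exact: measurable_steps.
    + exact: steps_separated.
    by rewrite pd; apply: fgeo_sum_le => //; rewrite mulr_ge0 ?ltW.
  apply/cvg_EFin; first exact: nearW.
  have inv0 : (n.+2%:R : R)^-1 @[n --> \oo] --> (0 : R).
    by have := @cvg_harmonic R; rewrite -cvg_shiftS.
  by rewrite -[X in _ --> X](mulr0 (4 * C)); exact: cvgM (cvg_cst _) inv0.
apply/cvgeyPge => M.
have c0 : 0 < (2 * b) ^+ d / 2 by rewrite divr_gt0// exprn_gt0// mulr_gt0.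
near=> n.
have Kn : K <= n.+2%:R.
  apply: (@le_trans _ _ n%:R); last by rewrite ler_nat -addn2 leq_addr.
  by near: n; exact: nbhs_infty_ger.
have gap : M / ((2 * b) ^+ d / 2) <=
    alpha * (n.+2%:R - K) `^ gamma - 2 * d%:R * (n.+2%:R * ln n.+2%:R).
  by near: n; apply: near_power_gap => //; rewrite mulr_ge0.
have mean_le : `|mean (eball c r) (steps delta c (s n))| <= delta * K.
  by rewrite /K -(s0 n); exact: normr_mean_steps_le.
have QsO : cube c (s n 0%N) `<=` eball c r by rewrite s0.
apply: le_trans (exp_integral_steps_ge delta0 (s_half n) d1 mO QsO
  (measurable_powR _) _ (ltW alpha0) mean_le Kn); last first.
  exact/ge0_ler_powR/ltW.
rewrite lee_fin /s fgeo_last.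
set N : R := n.+2%:R in gap *; set T := alpha * _ in gap *.
have -> : (2 * (b * expR (- (2 * ln N * n.+1%:R)))) ^+ d / 2 * expR T =
    (2 * b) ^+ d / 2 * expR (T - 2 * d%:R * (n.+1%:R * ln N)).
  have shuffle (x y z : R) : x * y / 2 * z = x / 2 * (y * z) by field.
  rewrite mulrA exprMn -expRM_natr shuffle -expRD.
  by congr (_ * expR _); ring.
rewrite -ler_pdivrMl// mulrC; apply: (le_trans gap).
have lnN0 : 0 <= ln N by rewrite ln_ge0// ler1n.
have nN : n.+1%:R * ln N <= N * ln N by rewrite ler_wpM2r// ler_nat.
have dN : 2 * d%:R * (n.+1%:R * ln N) <= 2 * d%:R * (N * ln N).
  by rewrite ler_wpM2l// mulr_ge0.
by have := expR_ge1Dx (T - 2 * d%:R * (n.+1%:R * ln N)); lra.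
Unshelve. all: by end_near. Qed.

End examples.

Theorem proposition1p7 (R : realType) (d : nat) (p gamma alpha delta : R)
    (c : d.-tuple (measurableTypeR R)) (r : R) :
  (1 <= d)%N -> d%:R <= p -> p / d%:R < gamma -> 0 < alpha -> 0 < delta ->
  0 < r ->
  (d%:R < p -> forall M : R, 0 < M ->
     exists u : d.-tuple (measurableTypeR R) -> R,
       [/\ (lebesgue_tuple d).-integrable (eball c r) (EFin \o u),
           (Idp delta p u (eball c r) <= M%:E)%E &
           (\int[lebesgue_tuple d]_(x in eball c r)
              (expR (alpha * gamma `^
                 (delta^-1 * `|u x - mean (eball c r) u|)))%:E)%E = +oo%E]) /\
  (p = d%:R ->
     exists u_ : nat -> d.-tuple (measurableTypeR R) -> R,
       [/\ forall n, (lebesgue_tuple d).-integrable (eball c r) (EFin \o u_ n),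
           exists C : R, forall n,
             (\int[lebesgue_tuple d]_(x in eball c r) `|u_ n x|%:E <= C%:E)%E,
           Idp delta p (u_ n) (eball c r) @[n --> \oo] --> 0%E &
           (\int[lebesgue_tuple d]_(x in eball c r)
              (expR (alpha * (delta^-1 *
                 `|u_ n x - mean (eball c r) (u_ n)|) `^ gamma))%:E)%E
             @[n --> \oo] --> +oo%E]).
Proof.
move=> d1 dp pg alpha0 delta0 r0; split.
  exact: infinite_exp_integral.
exact: unbounded_exp_integral.
Qed.
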